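(* Let $(A,\Delta)$ be a multiplier Hopf $^*$-algebra with positive integrals, let $\varphi$ be a positive left integral on $A$, and let $B$ be the dual $\hat A$ with the opposite comultiplication. Let $F:A\to B$ be the Fourier transform $F(x)=\varphi(\,\cdot\,x)$. For $a,x\in A$ and $b\in B$ put $\pi(a)x=ax$ and $\lambda(b)x=\langle S^{-1}(x_{(1)}),b\rangle x_{(2)}$ (operators on $A$), and for $a\in A$ and $b,y\in B$ put $\lambda(a)y=\langle a,y_{(1)}\rangle y_{(2)}$ and $\pi(b)y=by$ (operators on $B$). Then for all $a,x\in A$ and $b\in B$ $$F(\pi(a)x)=\lambda(a)F(x),\qquad F(\lambda(b)x)=\pi(b)F(x).$$
   Context: Algebras are over $\mathbb{C}$, possibly without identity, with non-degenerate product; $M(A)$ is the multiplier algebra of $A$ and $\iota$ is the identity map. A multiplier Hopf $^*$-algebra is a pair $(A,\Delta)$ of a $^*$-algebra $A$ (non-degenerate product) and a comultiplication $\Delta$ (a $^*$-homomorphism $\Delta:A\to M(A\otimes A)$ that is non-degenerate, i.e. $\Delta(A)(A\otimes A)=A\otimes A$, and coassociative, $(\Delta\otimes\iota)\Delta=(\iota\otimes\Delta)\Delta$) such that the maps $a\otimes a'\mapsto\Delta(a)(1\otimes a')$ and $a\otimes a'\mapsto(a\otimes1)\Delta(a')$ are injective on $A\otimes A$ with range $A\otimes A$. It has a unique counit $\varepsilon$ (a $^*$-homomorphism $A\to\mathbb{C}$) and a unique antipode $S$ (a bijective anti-homomorphism with $S(S(a)^* )^*=a$). A left integral is a non-zero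 functional $\varphi$ with $(\iota\otimes\varphi)\Delta(a)=\varphi(a)1$ (in $M(A)$); a right integral is a non-zero functional $\psi$ with $(\psi\otimes\iota)\Delta(a)=\psi(a)1$. Positive means $\varphi(a^*a)\ge0$ for all $a$. Integrals are unique up to a scalar and faithful. ''With positive integrals'' means a positive left and a positive right integral exist. Dual: $\hat A=\{\varphi(\,\cdot\,a):a\in A\}$ in the linear dual of $A$. $B$ denotes $\hat A$ as a $^*$-algebra with the opposite of the dual comultiplication. Writing $\langle a,b\rangle=b(a)$ for $a\in A$, $b\in B$, the structure of $B$ is given by $\langle a,bb'\rangle=\langle a_{(1)},b\rangle\langle a_{(2)},b'\rangle$, $\langle aa',b\rangle=\langle a,b_{(2)}\rangle\langle a',b_{(1)}\rangle$, $\langle a,b^*\rangle=\overline{\langle S(a)^*,b\rangle}$, $\langle S(a),b\rangle=\langle a,S^{-1}(b)\rangle$. $B$ is again a multiplier Hopf $^*$-algebra with positive integrals. Sweedler notation $\Delta(a)=a_{(1)}\otimes a_{(2)}$ is used, a leg being covered either by multiplication with an element or through the pairing (for each $b\in B$ there is $e\in A$ with $\langle a,b\rangle=\langle ea,b\rangle$ for all $a$, and similarly on the other side and with the roles of $A$ and $B$ exchanged), so that the expressions are well defined. *)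

(* Defs.v *)
From HB Require Import structures.
From mathcomp Require Import all_boot all_order all_algebra.
From mathcomp Require Import sesquilinear generic_quotient.
From mathcomp Require Import boolp classical_sets reals.
From mathcomp Require Import complex.

Set Implicit Arguments.
Unset Strict Implicit.
Unset Printing Implicit Defensive.

Import Order.TTheory GRing.Theory Num.Theory.

Local Open Scope ring_scope.
Local Open Scope quotient_scope.

Reserved Notation "u ⊗ v" (at level 38, left associativity).
Reserved Notation "a ∙ b" (at level 39, left associativity).

(* Algebraic tensor product: formal sums of pairs, two of them being          *)
(* identified when no bilinear map separates them.  [tensor_ind] and the      *)
(* [tlift] lemmas below give the universal property.                          *)
Section Tensor.
Variables (K : fieldType) (U V : lmodType K).

Definition formal_eval (W : zmodType) (f : U -> V -> W) (s : seq (U * V)) : W :=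
  \sum_(p <- s) f p.1 p.2.

Definition formal_eq (s1 s2 : seq (U * V)) : bool :=
  `[< forall (W : lmodType K) (f : U -> V -> W),
        bilinear_for *:%R *:%R f -> formal_eval f s1 = formal_eval f s2 >].

Lemma formal_eq_refl : reflexive formal_eq.
Proof. by move=> s; apply/asboolP. Qed.

Lemma formal_eq_sym : symmetric formal_eq.
Proof.
by move=> s1 s2; apply/asboolP/asboolP => h W f /h ->.
Qed.

Lemma formal_eq_trans : transitive formal_eq.
Proof.
move=> s2 s1 s3 /asboolP h12 /asboolP h23; apply/asboolP => W f hf.
by rewrite h12 // h23.
Qed.

Canonical formal_equiv :=
  EquivRel formal_eq formal_eq_refl formal_eq_sym formal_eq_trans.

Definition tensor : Type := {eq_quot formal_eq}.

HB.instance Definition _ := Choice.on tensor.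

Definition tensor_pi (s : seq (U * V)) : tensor := \pi_({eq_quot formal_eq}) s.
Definition tensor_repr (t : tensor) : seq (U * V) :=
  repr (t : {eq_quot formal_eq}).

Lemma tensor_reprK t : tensor_pi (tensor_repr t) = t.
Proof. exact: reprK. Qed.

Lemma tensor_piP s1 s2 :
  tensor_pi s1 = tensor_pi s2 <->
  (forall (W : lmodType K) (f : U -> V -> W),
     bilinear_for *:%R *:%R f -> formal_eval f s1 = formal_eval f s2).
Proof.
split=> [/eqquotP/asboolP //|h].
by apply/eqquotP/asboolP.
Qed.

Definition tlift (W : zmodType) (f : U -> V -> W) (t : tensor) : W :=
  formal_eval f (tensor_repr t).

Lemma tlift_pi (W : lmodType K) (f : U -> V -> W) s :
  bilinear_for *:%R *:%R f -> tlift f (tensor_pi s) = formal_eval f s.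
Proof.
by move=> hf; have /tensor_piP := tensor_reprK (tensor_pi s); apply.
Qed.

Lemma formal_eval_cat (W : zmodType) (f : U -> V -> W) s1 s2 :
  formal_eval f (s1 ++ s2) = formal_eval f s1 + formal_eval f s2.
Proof. by rewrite /formal_eval big_cat. Qed.

Definition formal_scale (k : K) (s : seq (U * V)) :=
  [seq (k *: p.1, p.2) | p <- s].

Lemma formal_eval_scale (W : lmodType K) (f : U -> V -> W) k s :
  bilinear_for *:%R *:%R f ->
  formal_eval f (formal_scale k s) = k *: formal_eval f s.
Proof.
case=> hl _; rewrite /formal_eval big_map scaler_sumr; apply: eq_bigr => p _ /=.
by have := scalable_linear (hl p.2) k p.1.
Qed.

Definition tadd (t1 t2 : tensor) :=
  tensor_pi (tensor_repr t1 ++ tensor_repr t2).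
Definition tscale (k : K) (t : tensor) :=
  tensor_pi (formal_scale k (tensor_repr t)).

Lemma tensor_ext t1 t2 :
  (forall (W : lmodType K) (f : U -> V -> W),
     bilinear_for *:%R *:%R f -> tlift f t1 = tlift f t2) -> t1 = t2.
Proof.
move=> h; rewrite -(tensor_reprK t1) -(tensor_reprK t2).
exact/tensor_piP.
Qed.

Lemma tliftD (W : lmodType K) (f : U -> V -> W) t1 t2 :
  bilinear_for *:%R *:%R f -> tlift f (tadd t1 t2) = tlift f t1 + tlift f t2.
Proof. by move=> hf; rewrite tlift_pi // formal_eval_cat. Qed.

Lemma tliftZ (W : lmodType K) (f : U -> V -> W) k t :
  bilinear_for *:%R *:%R f -> tlift f (tscale k t) = k *: tlift f t.
Proof. by move=> hf; rewrite tlift_pi // formal_eval_scale. Qed.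

Lemma tlift0 (W : lmodType K) (f : U -> V -> W) :
  bilinear_for *:%R *:%R f -> tlift f (tensor_pi [::]) = 0.
Proof. by move=> hf; rewrite tlift_pi // /formal_eval big_nil. Qed.

Fact tensor_addA : associative tadd.
Proof. by move=> ? ? ?; apply: tensor_ext => W f hf; rewrite !tliftD // addrA. Qed.
Fact tensor_addC : commutative tadd.
Proof. by move=> ? ?; apply: tensor_ext => W f hf; rewrite !tliftD // addrC. Qed.
Fact tensor_add0 : left_id (tensor_pi [::]) tadd.
Proof.
by move=> ?; apply: tensor_ext => W f hf; rewrite tliftD // tlift0 // add0r.
Qed.
Fact tensor_addN : left_inverse (tensor_pi [::]) (tscale (-1)) tadd.
Proof.
move=> ?; apply: tensor_ext => W f hf.
by rewrite tliftD // tliftZ // tlift0 // scaleN1r addNr.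
Qed.

HB.instance Definition _ :=
  GRing.isZmodule.Build tensor tensor_addA tensor_addC tensor_add0 tensor_addN.

Fact tensor_scaleA a b t : tscale a (tscale b t) = tscale (a * b) t.
Proof. by apply: tensor_ext => W f hf; rewrite !tliftZ // scalerA. Qed.
Fact tensor_scale1 : left_id 1 tscale.
Proof. by move=> t; apply: tensor_ext => W f hf; rewrite tliftZ // scale1r. Qed.
Fact tensor_scaleDr : right_distributive tscale +%R.
Proof.
move=> k t1 t2; apply: tensor_ext => W f hf.
by rewrite tliftD // !tliftZ // tliftD // scalerDr.
Qed.
Fact tensor_scaleDl t : {morph tscale^~ t : a b / a + b}.
Proof.
move=> a b; apply: tensor_ext => W f hf.
by rewrite tliftD // !tliftZ // scalerDl.
Qed.

HB.instance Definition _ := GRing.Zmodule_isLmodule.Build K tensor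
  tensor_scaleA tensor_scale1 tensor_scaleDr tensor_scaleDl.

Definition tens (u : U) (v : V) : tensor := tensor_pi [:: (u, v)].

Lemma tliftE (W : lmodType K) (f : U -> V -> W) u v :
  bilinear_for *:%R *:%R f -> tlift f (tens u v) = f u v.
Proof. by move=> hf; rewrite tlift_pi // /formal_eval big_seq1. Qed.

Lemma tlift_linear (W : lmodType K) (f : U -> V -> W) :
  bilinear_for *:%R *:%R f -> linear (tlift f).
Proof. by move=> hf k t1 t2; rewrite tliftD // tliftZ. Qed.

Lemma tens_bilinear : bilinear_for *:%R *:%R tens.
Proof.
split=> [v|u] k x y; apply: tensor_ext => W f hf;
  rewrite (tlift_linear hf) !tliftE //.
- exact: hf.1.
- exact: hf.2.
Qed.

Lemma tensor_sum t : t = \sum_(p <- tensor_repr t) tens p.1 p.2.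
Proof.
apply: tensor_ext => W f hf.
pose g : {linear tensor -> W} := HB.pack (tlift f)
  (GRing.isLinear.Build _ _ _ _ (tlift f) (tlift_linear hf)).
rewrite -[RHS]/(g _) raddf_sum /=.
by apply: eq_bigr => p _; rewrite tliftE.
Qed.

Lemma tensor_ind (P : tensor -> Prop) :
  P 0 -> (forall u v t, P t -> P (tens u v + t)) -> forall t, P t.
Proof.
move=> P0 PD t; rewrite (tensor_sum t).
elim: (tensor_repr t) => [|p s IHs]; first by rewrite big_nil.
by rewrite big_cons; apply: PD.
Qed.

Lemma tlift_unique (W : lmodType K) (f : U -> V -> W) (g : tensor -> W) :
  bilinear_for *:%R *:%R f -> linear g -> (forall u v, g (tens u v) = f u v) ->
  g =1 tlift f.
Proof.
move=> hf hg gE t.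
pose g' : {linear tensor -> W} := HB.pack g
  (GRing.isLinear.Build _ _ _ _ g hg).
rewrite {1}(tensor_sum t) -[LHS]/(g' _) raddf_sum.
by apply: eq_bigr => p _; apply: gE.
Qed.

End Tensor.

Notation "u ⊗ v" := (tens u v) : ring_scope.

Lemma tensor_linear_ext (K : fieldType) (U V W : lmodType K)
    (f g : tensor U V -> W) :
  linear f -> linear g -> (forall u v, f (u ⊗ v) = g (u ⊗ v)) -> f =1 g.
Proof.
move=> hf hg fg t.
have hb : bilinear_for *:%R *:%R (fun u v => g (u ⊗ v)).
  by split=> [v|u] k x y; rewrite ?(tens_bilinear U V).1 ?(tens_bilinear U V).2 hg.
by rewrite (tlift_unique hb hf) // (tlift_unique hb hg).
Qed.

Section TensorMaps.
Variable K : fieldType.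

Definition tmap (U V U' V' : lmodType K) (f : U -> U') (g : V -> V') :
    tensor U V -> tensor U' V' := tlift (fun u v => f u ⊗ g v).

Definition slice_fst (U V : lmodType K) (f : U -> K) : tensor U V -> V :=
  tlift (fun u v => f u *: v).

Definition slice_snd (U V : lmodType K) (f : V -> K) : tensor U V -> U :=
  tlift (fun u v => f v *: u).

Definition tassoc (U V W : lmodType K) :
    tensor (tensor U V) W -> tensor U (tensor V W) :=
  tlift (fun t w => tlift (fun u v => u ⊗ (v ⊗ w)) t).

Lemma tmap_bilinear (U V U' V' : lmodType K) (f : U -> U') (g : V -> V') :
  linear f -> linear g -> bilinear_for *:%R *:%R (fun u v => f u ⊗ g v).
Proof.
move=> hf hg; split=> [v|u] k x y /=.
- by rewrite hf (tens_bilinear U' V').1.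
- by rewrite hg (tens_bilinear U' V').2.
Qed.

Lemma tmap_linear (U V U' V' : lmodType K) (f : U -> U') (g : V -> V') :
  linear f -> linear g -> linear (tmap f g).
Proof. by move=> hf hg; apply/tlift_linear/tmap_bilinear. Qed.

Lemma tmapE (U V U' V' : lmodType K) (f : U -> U') (g : V -> V') u v :
  linear f -> linear g -> tmap f g (u ⊗ v) = f u ⊗ g v.
Proof. by move=> hf hg; rewrite [LHS]tliftE //; apply: tmap_bilinear. Qed.

End TensorMaps.

(* Associative algebras, with or without identity. *)
HB.mixin Record Lmodule_isNAlgebra (K : fieldType) A of GRing.Lmodule K A := {
  nmul : A -> A -> A;
  nmul_bilinear : bilinear_for *:%R *:%R nmul;
  nmulA : associative nmul
}.

#[short(type="nalgType")]
HB.structure Definition NAlgebra (K : fieldType) :=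
  {A of GRing.Lmodule K A & Lmodule_isNAlgebra K A}.

Notation "a ∙ b" := (nmul a b) : ring_scope.

Definition nondegenerate (K : fieldType) (A : nalgType K) : Prop :=
  (forall a : A, (forall b : A, a ∙ b = 0) -> a = 0) /\
  (forall a : A, (forall b : A, b ∙ a = 0) -> a = 0).

Section NAlgebraTheory.
Variables (K : fieldType) (A : nalgType K).
Implicit Types a b c : A.

Lemma nmul_linl b : linear (fun a => a ∙ b).
Proof. exact: nmul_bilinear.1. Qed.
Lemma nmul_linr a : linear (fun b => a ∙ b).
Proof. exact: nmul_bilinear.2. Qed.

End NAlgebraTheory.

Section TensorAlgebra.
Variables (K : fieldType) (A B : nalgType K).

Definition tmul (s t : tensor A B) : tensor A B :=
  tlift (fun a b => tmap (nmul a) (nmul b) t) s.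

Lemma tmul_bilinear_subproof (t : tensor A B) :
  bilinear_for *:%R *:%R (fun a b => tmap (nmul a) (nmul b) t).
Proof.
split=> [b|a] k x y /=.
- rewrite /tmap /tlift /formal_eval scaler_sumr -big_split /=.
  by apply: eq_bigr => p _; rewrite nmul_linl (tens_bilinear _ _).1.
- rewrite /tmap /tlift /formal_eval scaler_sumr -big_split /=.
  by apply: eq_bigr => p _; rewrite nmul_linl (tens_bilinear _ _).2.
Qed.

Lemma tmul_bilinear : bilinear_for *:%R *:%R tmul.
Proof.
split=> [t|s] k x y /=.
- by apply: tlift_linear; apply: tmul_bilinear_subproof.
- rewrite /tmul /tlift /formal_eval scaler_sumr -big_split /=.
  by apply: eq_bigr => p _; rewrite tmap_linear //; apply: nmul_linr.
Qed.

Lemma tmul_tens a b c d : tmul (a ⊗ b) (c ⊗ d) = (a ∙ c) ⊗ (b ∙ d).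
Proof.
rewrite /tmul tliftE; last exact: tmul_bilinear_subproof.
by rewrite tmapE //; apply: nmul_linr.
Qed.

Lemma tmulA : associative tmul.
Proof.
move=> r s t; move: r.
apply: tensor_linear_ext => [k x y|k x y|a b]; rewrite ?tmul_bilinear.1 //.
move: s; apply: tensor_linear_ext => [k x y|k x y|c d].
- by rewrite tmul_bilinear.1 tmul_bilinear.2.
- by rewrite tmul_bilinear.2 tmul_bilinear.1.
move: t; apply: tensor_linear_ext => [k x y|k x y|e f].
- by rewrite !tmul_bilinear.2.
- by rewrite !tmul_bilinear.2.
by rewrite !tmul_tens !nmulA.
Qed.

HB.instance Definition _ :=
  Lmodule_isNAlgebra.Build K (tensor A B) tmul_bilinear tmulA.

Lemma nmul_tens (a c : A) (b d : B) : (a ⊗ b) ∙ (c ⊗ d) = (a ∙ c) ⊗ (b ∙ d).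
Proof. exact: tmul_tens. Qed.

End TensorAlgebra.

HB.mixin Record NAlgebra_isStarAlgebra (K : numClosedFieldType) A
    of NAlgebra K A := {
  star : A -> A;
  star_antilinear : forall (k : K) (a b : A),
    star (k *: a + b) = k^* *: star a + star b;
  star_antimul : forall a b : A, star (a ∙ b) = star b ∙ star a;
  starK : involutive star
}.

#[short(type="starAlgType")]
HB.structure Definition StarAlgebra (K : numClosedFieldType) :=
  {A of NAlgebra K A & NAlgebra_isStarAlgebra K A}.

Section ConjugateModule.
Variables (K : numClosedFieldType) (V : lmodType K).

Definition conj_module : Type := V.

HB.instance Definition _ := GRing.Zmodule.on conj_module.

Definition conj_scale (k : K) (v : conj_module) : conj_module :=
  (k^* *: (v : V)).

Fact conj_scaleA a b v : conj_scale a (conj_scale b v) = conj_scale (a * b) v.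
Proof. by rewrite /conj_scale scalerA rmorphM. Qed.
Fact conj_scale1 : left_id 1 conj_scale.
Proof. by move=> v; rewrite /conj_scale rmorph1 scale1r. Qed.
Fact conj_scaleDr : right_distributive conj_scale +%R.
Proof. by move=> k u v; rewrite /conj_scale scalerDr. Qed.
Fact conj_scaleDl v : {morph conj_scale^~ v : a b / a + b}.
Proof. by move=> a b; rewrite /conj_scale rmorphD scalerDl. Qed.

HB.instance Definition _ := GRing.Zmodule_isLmodule.Build K conj_module
  conj_scaleA conj_scale1 conj_scaleDr conj_scaleDl.

End ConjugateModule.

Section TensorStar.
Variables (K : numClosedFieldType) (A B : starAlgType K).

Definition tstar : tensor A B -> tensor A B :=
  tlift (fun a b => star a ⊗ star b).

Let tstar' : tensor A B -> conj_module (tensor A B) :=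
  tlift (fun a b => star a ⊗ star b : conj_module (tensor A B)).

Lemma tstar_bilinear_subproof :
  bilinear_for *:%R *:%R
    (fun (a : A) (b : B) => star a ⊗ star b : conj_module (tensor A B)).
Proof.
split=> [b|a] k x y /=; rewrite star_antilinear.
- by rewrite (tens_bilinear _ _).1.
- by rewrite (tens_bilinear _ _).2.
Qed.

Lemma tstar_antilinear k s t : tstar (k *: s + t) = k^* *: tstar s + tstar t.
Proof. exact: (tlift_linear tstar_bilinear_subproof k s t). Qed.

Lemma tstar_tens a b : tstar (a ⊗ b) = star a ⊗ star b.
Proof. exact: (tliftE a b tstar_bilinear_subproof). Qed.

Lemma tstar0 : tstar 0 = 0.
Proof. by have := tstar_antilinear (-1) 0 0; rewrite scaler0 addr0 rmorphN1 scaleN1r addNr. Qed.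

Lemma tstarD s t : tstar (s + t) = tstar s + tstar t.
Proof. by have := tstar_antilinear 1 s t; rewrite rmorph1 !scale1r. Qed.

Lemma tstar_antimul s t : tstar (s ∙ t) = tstar t ∙ tstar s.
Proof.
have nD (x y z : tensor A B) : (x + y) ∙ z = x ∙ z + y ∙ z.
  by have := nmul_linl z 1 x y; rewrite !scale1r.
have nDr (x y z : tensor A B) : x ∙ (y + z) = x ∙ y + x ∙ z.
  by have := nmul_linr x 1 y z; rewrite !scale1r.
have n0 (z : tensor A B) : 0 ∙ z = 0.
  by have := nmul_linl z (-1) 0 0; rewrite scaler0 addr0 scaleN1r addNr.
have n0r (z : tensor A B) : z ∙ 0 = 0.
  by have := nmul_linr z (-1) 0 0; rewrite scaler0 addr0 scaleN1r addNr.
elim/tensor_ind: s => [|a b s IHs]; first by rewrite n0 tstar0 n0r.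
rewrite nD !tstarD nDr IHs; congr (_ + _); clear IHs.
elim/tensor_ind: t => [|c d t IHt]; first by rewrite n0r tstar0 n0.
rewrite nDr !tstarD nD IHt; congr (_ + _).
by rewrite !(nmul_tens, tstar_tens) !star_antimul.
Qed.

Lemma tstarK : involutive tstar.
Proof.
elim/tensor_ind => [|a b t IHt]; first by rewrite !tstar0.
by rewrite !tstarD IHt !tstar_tens !starK.
Qed.

HB.instance Definition _ := NAlgebra_isStarAlgebra.Build K (tensor A B)
  tstar_antilinear tstar_antimul tstarK.

End TensorStar.

(* A multiplier m is the pair of maps [mull m] : b |-> m b and                *)
(* [mulr m] : a |-> a m.                                                      *)
Record multiplier (K : fieldType) (A : nalgType K) := Multiplier {
  mull : A -> A;
  mulr : A -> A;
  mull_linear : linear mull;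
  mulr_linear : linear mulr;
  mulr_mull : forall a b : A, mulr a ∙ b = a ∙ mull b
}.

Section MultiplierAlgebra.
Variables (K : fieldType) (A : nalgType K).
Local Notation M := (multiplier A).
Implicit Types (m n : M) (a b : A).

HB.instance Definition _ := gen_eqMixin M.
HB.instance Definition _ := gen_choiceMixin M.

Lemma multiplier_ext m n : mull m =1 mull n -> mulr m =1 mulr n -> m = n.
Proof.
case: m n => [l r hl hr hlr] [l' r' hl' hr' hlr'] /= /funext el /funext er.
move: hl hr hlr hl' hr' hlr'; rewrite el er => *.
by congr Multiplier; apply: Prop_irrelevance.
Qed.

Lemma nmulDl a b c : (a + b) ∙ c = a ∙ c + b ∙ c.
Proof. by have := nmul_linl c 1 a b; rewrite !scale1r. Qed.
Lemma nmulDr a b c : a ∙ (b + c) = a ∙ b + a ∙ c.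
Proof. by have := nmul_linr a 1 b c; rewrite !scale1r. Qed.
Lemma nmul0l a : 0 ∙ a = 0.
Proof. by apply: (addrI (0 ∙ a)); rewrite -nmulDl !addr0. Qed.
Lemma nmul0r a : a ∙ 0 = 0.
Proof. by apply: (addrI (a ∙ 0)); rewrite -nmulDr !addr0. Qed.
Lemma nmulZl k a b : (k *: a) ∙ b = k *: (a ∙ b).
Proof. by have := nmul_linl b k a 0; rewrite nmul0l !addr0. Qed.
Lemma nmulZr k a b : a ∙ (k *: b) = k *: (a ∙ b).
Proof. by have := nmul_linr a k b 0; rewrite nmul0r !addr0. Qed.

Lemma zero_linear : linear ((fun=> 0) : A -> A).
Proof. by move=> k x y; rewrite scaler0 addr0. Qed.
Lemma add_linear (f g : A -> A) :
  linear f -> linear g -> linear (fun a => f a + g a).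
Proof. by move=> hf hg k x y; rewrite hf hg scalerDr addrACA. Qed.
Lemma scale_linear k (f : A -> A) : linear f -> linear (fun a => k *: f a).
Proof. by move=> hf l x y; rewrite hf scalerDr !scalerA mulrC. Qed.
Lemma comp_linear (f g : A -> A) : linear f -> linear g -> linear (f \o g).
Proof. by move=> hf hg k x y /=; rewrite hg hf. Qed.

Fact mzero_compat a b : (0 : A) ∙ b = a ∙ 0.
Proof. by rewrite nmul0l nmul0r. Qed.
Definition mzero : M := Multiplier zero_linear zero_linear mzero_compat.

Fact madd_compat m n a b :
  (mulr m a + mulr n a) ∙ b = a ∙ (mull m b + mull n b).
Proof. by rewrite nmulDl nmulDr !mulr_mull. Qed.
Definition madd m n : M :=
  Multiplier (add_linear (mull_linear m) (mull_linear n))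
    (add_linear (mulr_linear m) (mulr_linear n)) (madd_compat m n).

Fact mscale_compat k m a b : (k *: mulr m a) ∙ b = a ∙ (k *: mull m b).
Proof. by rewrite nmulZl nmulZr mulr_mull. Qed.
Definition mscale k m : M :=
  Multiplier (scale_linear k (mull_linear m)) (scale_linear k (mulr_linear m))
    (mscale_compat k m).

Fact mmul_compat m n a b :
  (mulr n \o mulr m) a ∙ b = a ∙ (mull m \o mull n) b.
Proof. by rewrite /= !mulr_mull. Qed.
Definition mmul m n : M :=
  Multiplier (comp_linear (mull_linear m) (mull_linear n))
    (comp_linear (mulr_linear n) (mulr_linear m)) (mmul_compat m n).

Fact id_linear : linear (@id A). Proof. by []. Qed.
Definition mone : M := Multiplier id_linear id_linear (fun a b => erefl (a ∙ b)).

Definition memb a : M :=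
  Multiplier (nmul_linr a) (nmul_linl a) (fun b c => esym (nmulA b a c)).

Fact maddA : associative madd.
Proof. by move=> m n p; apply: multiplier_ext => a /=; rewrite addrA. Qed.
Fact maddC : commutative madd.
Proof. by move=> m n; apply: multiplier_ext => a /=; rewrite addrC. Qed.
Fact madd0 : left_id mzero madd.
Proof. by move=> m; apply: multiplier_ext => a /=; rewrite add0r. Qed.
Fact maddN : left_inverse mzero (mscale (-1)) madd.
Proof. by move=> m; apply: multiplier_ext => a /=; rewrite scaleN1r addNr. Qed.

HB.instance Definition _ := GRing.isZmodule.Build M maddA maddC madd0 maddN.

Fact mscaleA k l m : mscale k (mscale l m) = mscale (k * l) m.
Proof. by apply: multiplier_ext => a /=; rewrite scalerA. Qed.
Fact mscale1 : left_id 1 mscale.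
Proof. by move=> m; apply: multiplier_ext => a /=; rewrite scale1r. Qed.
Fact mscaleDr : right_distributive mscale +%R.
Proof. by move=> k m n; apply: multiplier_ext => a /=; rewrite scalerDr. Qed.
Fact mscaleDl m : {morph mscale^~ m : k l / k + l}.
Proof. by move=> k l; apply: multiplier_ext => a /=; rewrite scalerDl. Qed.

HB.instance Definition _ := GRing.Zmodule_isLmodule.Build K M
  mscaleA mscale1 mscaleDr mscaleDl.

Fact mmul_bilinear : bilinear_for *:%R *:%R mmul.
Proof.
by split=> [n|m] k x y; apply: multiplier_ext => a //=;
  rewrite ?mull_linear ?mulr_linear.
Qed.
Fact mmulA : associative mmul.
Proof. by move=> m n p; apply: multiplier_ext. Qed.

HB.instance Definition _ := Lmodule_isNAlgebra.Build K M mmul_bilinear mmulA.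

End MultiplierAlgebra.

Arguments mone {K A}.

Section MultiplierStar.
Variables (K : numClosedFieldType) (A : starAlgType K).
Local Notation M := (multiplier A).

Lemma star_conj_linear (f : A -> A) :
  linear f -> linear (fun a => star (f (star a))).
Proof.
by move=> hf k x y; rewrite star_antilinear hf star_antilinear conjCK.
Qed.

Fact mstar_compat (m : M) a b :
  star (mull m (star a)) ∙ b = a ∙ star (mulr m (star b)).
Proof.
rewrite -[b in LHS]starK -star_antimul -mulr_mull star_antimul.
by rewrite starK.
Qed.
Definition mstar (m : M) : M :=
  Multiplier (star_conj_linear (mulr_linear m))
    (star_conj_linear (mull_linear m)) (mstar_compat m).

Fact mstar_antilinear k (m n : M) :
  mstar (k *: m + n) = k^* *: mstar m + mstar n.
Proof. by apply: multiplier_ext => a /=; rewrite star_antilinear. Qed.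
Fact mstar_antimul (m n : M) : mstar (m ∙ n) = mstar n ∙ mstar m.
Proof. by apply: multiplier_ext => a /=; rewrite starK. Qed.
Fact mstarK : involutive mstar.
Proof. by move=> m; apply: multiplier_ext => a /=; rewrite !starK. Qed.

HB.instance Definition _ := NAlgebra_isStarAlgebra.Build K M
  mstar_antilinear mstar_antimul mstarK.

End MultiplierStar.

Section MultiplierTensor.
Variables (K : fieldType) (A B : nalgType K).

Fact mtens_compat (m : multiplier A) (n : multiplier B) (s t : tensor A B) :
  tmap (mulr m) (mulr n) s ∙ t = s ∙ tmap (mull m) (mull n) t.
Proof.
have hr := tmap_linear (mulr_linear m) (mulr_linear n).
have hl := tmap_linear (mull_linear m) (mull_linear n).
move: s; apply: tensor_linear_ext => [k x y|k x y|a b].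
- by rewrite hr nmul_linl.
- by rewrite nmul_linl.
move: t; apply: tensor_linear_ext => [k x y|k x y|c d].
- by rewrite nmul_linr.
- by rewrite hl nmul_linr.
rewrite !tmapE; try exact: mull_linear; try exact: mulr_linear.
by rewrite !nmul_tens !mulr_mull.
Qed.

Definition mtens (m : multiplier A) (n : multiplier B) :
    multiplier (tensor A B) :=
  Multiplier (tmap_linear (mull_linear m) (mull_linear n))
    (tmap_linear (mulr_linear m) (mulr_linear n)) (mtens_compat m n).

End MultiplierTensor.

(* n is the value at m of the extension to M(A) of a non-degenerate           *)
(* homomorphism h : A -> M(B).                                                *)
Definition is_extension_at (K : fieldType) (A B : nalgType K)
    (h : A -> multiplier B) (m : multiplier A) (n : multiplier B) : Prop :=
  forall a : A, n ∙ h a = h (mull m a) /\ h a ∙ n = h (mulr m a).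

(* Slicing an element of M(A ⊗ B): m' = (f ⊗ ι)(m) in M(B), the second leg    *)
(* being covered by multiplication with an element of B; similarly for        *)
(* (ι ⊗ g)(m) in M(A).                                                        *)
Definition is_slice_fst (K : fieldType) (A B : nalgType K) (f : A -> K)
    (m : multiplier (tensor A B)) (m' : multiplier B) : Prop :=
  forall c : B,
    (exists t, memb t = m ∙ mtens mone (memb c) /\ mull m' c = slice_fst f t) /\
    (exists t, memb t = mtens mone (memb c) ∙ m /\ mulr m' c = slice_fst f t).

Definition is_slice_snd (K : fieldType) (A B : nalgType K) (g : B -> K)
    (m : multiplier (tensor A B)) (m' : multiplier A) : Prop :=
  forall c : A,
    (exists t, memb t = m ∙ mtens (memb c) mone /\ mull m' c = slice_snd g t) /\
    (exists t, memb t = mtens (memb c) mone ∙ m /\ mulr m' c = slice_snd g t).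

Section MultiplierHopfAxioms.
Variables (K : numClosedFieldType) (A : starAlgType K).
Variable Delta : A -> multiplier (tensor A A).

Definition is_star_hom : Prop :=
  [/\ linear Delta,
      forall a b : A, Delta (a ∙ b) = Delta a ∙ Delta b &
      forall a : A, Delta (star a) = star (Delta a)].

(* Δ(A)(A ⊗ A) = A ⊗ A *)
Definition is_nondegenerate_hom : Prop :=
  forall t : tensor A A, exists s : seq (A * tensor A A),
    t = \sum_(p <- s) mull (Delta p.1) p.2.

(* Δ ⊗ ι : A ⊗ A -> M((A ⊗ A) ⊗ A) and ι ⊗ Δ : A ⊗ A -> M(A ⊗ (A ⊗ A)) *)
Definition Delta_tens_id :
    tensor A A -> multiplier (tensor (tensor A A) A) :=
  tlift (fun a b => mtens (Delta a) (memb b)).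
Definition id_tens_Delta :
    tensor A A -> multiplier (tensor A (tensor A A)) :=
  tlift (fun a b => mtens (memb a) (Delta b)).

(* (Δ ⊗ ι)Δ = (ι ⊗ Δ)Δ, with Δ ⊗ ι and ι ⊗ Δ extended to M(A ⊗ A) *)
Definition is_coassociative : Prop :=
  forall a : A, exists n1 n2,
    [/\ is_extension_at Delta_tens_id (Delta a) n1,
        is_extension_at id_tens_Delta (Delta a) n2,
        forall t, tassoc (mull n1 t) = mull n2 (tassoc t) &
        forall t, tassoc (mulr n1 t) = mulr n2 (tassoc t)].

(* a ⊗ a' |-> Δ(a)(1 ⊗ a') and a ⊗ a' |-> (a ⊗ 1)Δ(a') *)
Definition galois_r : tensor A A -> multiplier (tensor A A) :=
  tlift (fun a a' => Delta a ∙ mtens mone (memb a')).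
Definition galois_l : tensor A A -> multiplier (tensor A A) :=
  tlift (fun a a' => mtens (memb a) mone ∙ Delta a').

End MultiplierHopfAxioms.

Record multHopfStarAlg (K : numClosedFieldType) := MultHopfStarAlg {
  mhs_alg :> starAlgType K;
  mhs_nondegenerate : nondegenerate mhs_alg;
  comul : mhs_alg -> multiplier (tensor mhs_alg mhs_alg);
  comul_star_hom : is_star_hom comul;
  comul_nondegenerate : is_nondegenerate_hom comul;
  comul_coassoc : is_coassociative comul;
  galois_r_inj : injective (galois_r comul);
  galois_r_range : range (galois_r comul) = range (@memb K _);
  galois_l_inj : injective (galois_l comul);
  galois_l_range : range (galois_l comul) = range (@memb K _)
}.

Section MultiplierHopfNotions.
Variables (K : numClosedFieldType) (A : multHopfStarAlg K).

(* (ε ⊗ ι)Δ(a) = a = (ι ⊗ ε)Δ(a) *)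
Definition is_counit (eps : A -> K) : Prop :=
  [/\ scalar eps,
      forall a b : A, eps (a ∙ b) = eps a * eps b,
      forall a : A, eps (star a) = (eps a)^*,
      forall a : A, is_slice_fst eps (comul a) (memb a) &
      forall a : A, is_slice_snd eps (comul a) (memb a)].

(* The last two clauses are m(S ⊗ ι)(Δ(a)(1 ⊗ b)) = ε(a)b and                 *)
(* m(ι ⊗ S)((a ⊗ 1)Δ(b)) = ε(b)a.                                             *)
Definition is_antipode (S : A -> A) : Prop :=
  [/\ linear S, bijective S,
      forall a b : A, S (a ∙ b) = S b ∙ S a,
      forall a : A, star (S (star (S a))) = a &
      exists eps : A -> K,
        [/\ is_counit eps,
            forall (a b : A) t, memb t = comul a ∙ mtens mone (memb b) ->
              tlift (fun u v => S u ∙ v) t = eps a *: b &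
            forall (a b : A) t, memb t = mtens (memb a) mone ∙ comul b ->
              tlift (fun u v => u ∙ S v) t = eps b *: a]].

Definition left_integral (phi : A -> K) : Prop :=
  [/\ scalar phi, exists a : A, phi a != 0 &
      forall a : A, is_slice_snd phi (comul a) (phi a *: mone)].

Definition right_integral (psi : A -> K) : Prop :=
  [/\ scalar psi, exists a : A, psi a != 0 &
      forall a : A, is_slice_fst psi (comul a) (psi a *: mone)].

Definition positive_functional (w : A -> K) : Prop :=
  forall a : A, 0 <= w (star a ∙ a).

(* f(x_(1)) x_(2), an element of A whenever the first leg is covered by the   *)
(* functional f; the product of A being non-degenerate, it is unique.         *)
Definition sweedler_fst (f : A -> K) (x : A) : A :=
  xget 0 [set z | is_slice_fst f (comul x) (memb z)].

End MultiplierHopfNotions.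

(* B, through the pairing <a, b> = b(a), is the space of functionals          *)
(* {φ( . x) : x in A} with the dual product and involution and the opposite   *)
(* of the dual comultiplication.  The clauses from [dual_mul] on read         *)
(*   <a, b b'> = <a_(1), b><a_(2), b'>,                                       *)
(*   <a a', b> = <a, b_(2)><a', b_(1)>,                                       *)
(*   <a, b^*> = conj <S(a)^*, b>,   <S(a), S(b)> = <a, b>.                    *)
Record is_op_dual (K : numClosedFieldType) (A : multHopfStarAlg K)
    (S : A -> A) (phi : A -> K) (B : multHopfStarAlg K) (pr : A -> B -> K) :
    Prop := IsOpDual {
  dual_linear : forall a, scalar (pr a);
  dual_inj : forall b b', pr^~ b =1 pr^~ b' -> b = b';
  dual_range : range (fun (b : B) (a : A) => pr a b) =
               range (fun (x : A) (a : A) => phi (a ∙ x));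
  dual_mul : forall a b b',
    pr a (b ∙ b') = pr (sweedler_fst (pr^~ b) a) b';
  dual_comul : forall a a' b,
    pr (a ∙ a') b = pr a (sweedler_fst (pr a') b);
  dual_star : forall a b, pr a (star b) = (pr (star (S a)) b)^*;
  dual_antipode : forall S_B : B -> B, is_antipode S_B ->
    forall a b, pr (S a) (S_B b) = pr a b
}.

Section Operators.
Variables (K : numClosedFieldType) (A B : multHopfStarAlg K).
Variables (pr : A -> B -> K) (Sinv : A -> A).

(* π(a)x = ax on A, and π(b)y = by on B *)
Definition op_pi (H : multHopfStarAlg K) (a x : H) : H := a ∙ x.

(* λ(b)x = <S^-1(x_(1)), b> x_(2) on A *)
Definition lambda_on_A (b : B) (x : A) : A :=
  sweedler_fst (fun u => pr (Sinv u) b) x.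

(* λ(a)y = <a, y_(1)> y_(2) on B *)
Definition lambda_on_B (a : A) (y : B) : B := sweedler_fst (pr a) y.

End Operators.

(* Main.v *)
Require Import Defs.
From HB Require Import structures.
From mathcomp Require Import all_boot all_order all_algebra.
From mathcomp Require Import boolp classical_sets reals.
From mathcomp Require Import complex.

Set Implicit Arguments.
Unset Strict Implicit.
Unset Printing Implicit Defensive.

Import Order.TTheory GRing.Theory Num.Theory.

Local Open Scope ring_scope.

(** Both identities are tested against the pairing, which separates the points
of the dual.

The first is then the rule <ca, y> = <c, y_(2)><a, y_(1)> for the pairing of a
product, applied to y = F(x): both sides pair with c to φ(cax).

For the second, write b = φ( . y). Pairing with c turns the claim into
<<
    φ(c_(1) y) φ(c_(2) x) = φ(S^-1(x_(1)) y) φ(c x_(2)),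
>>
and this follows from the strong form of left invariance
[strong_left_invariance],
<<
    S(c_(1)) φ(c_(2) x) = x_(1) φ(c x_(2)),
>>
by applying S^-1, multiplying by y on the right and applying φ.

Strong left invariance comes from computing S(c_(1)) c_(2) x_(1) φ(c_(3) x_(2))
in two ways: left invariance of φ applied to c_(2) x collapses it to
S(c_(1)) φ(c_(2) x), and the antipode identity S(c_(1)) c_(2) = ε(c) collapses
it to x_(1) φ(c x_(2)). As A need not have an identity, every leg has to be covered: the
two readings are the two sides of the coassociativity identity
[coassoc_covered] between elements of A ⊗ (A ⊗ A).

Coverings are elements of A ⊗ A that are only known as multipliers, so the
argument needs A ⊗ A and A ⊗ (A ⊗ A) to embed into their multiplier algebras,
that is, to have a non-degenerate product [nondegenerate_tensor]. This rests on
the fact that linear functionals separate the points of a vector space, proved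
from Zorn's lemma [separating_functional]. *)

(** * Linear maps *)

Section LinearMaps.
Variable K : fieldType.

Lemma linear0 (U V : lmodType K) (f : U -> V) : linear f -> f 0 = 0.
Proof. by move=> fl; have := scalable_linear fl 0 0; rewrite /= !scale0r. Qed.

Lemma linear_comb (U V : lmodType K) k (f g : U -> V) :
  linear f -> linear g -> linear (fun u => k *: f u + g u).
Proof.
by move=> fl gl l x y; rewrite fl gl !scalerDr !scalerA mulrC addrACA.
Qed.

Lemma linear_sum_ext (I : Type) (U W : lmodType K) (f g : U -> W)
    (s : seq I) (F : I -> U) :
  linear f -> linear g -> (forall i, f (F i) = g (F i)) ->
  f (\sum_(i <- s) F i) = g (\sum_(i <- s) F i).
Proof.
move=> fl gl fg; elim: s => [|i s IHs]; first by rewrite big_nil !linear0.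
by rewrite big_cons -[F i]scale1r fl gl fg IHs.
Qed.

Lemma scalarZ (V : lmodType K) (f : V -> K) k v :
  scalar f -> f (k *: v) = k * f v.
Proof. by move=> fl; apply: (scalable_linear (fl : linear (f : V -> K^o))). Qed.

End LinearMaps.

(** * Linear functionals separate points *)

Section Functionals.
Variables (K : fieldType) (V : lmodType K).
Local Open Scope classical_set_scope.

Definition linear_subspace (M : set V) : Prop :=
  M 0 /\ forall k x y, M x -> M y -> M (k *: x + y).

(** Zorn's lemma is applied to the sets X for which M0 ∪ X is a subspace avoiding
v, rather than to the subspaces containing M0, because the union of the empty
chain must qualify. *)
Lemma maximal_subspace_avoiding (M0 : set V) v :
  linear_subspace M0 -> ~ M0 v ->
  exists M, [/\ linear_subspace M, M0 `<=` M, ~ M v &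
    forall N, linear_subspace N -> M `<=` N -> ~ N v -> N `<=` M].
Proof.
move=> [M00 M0l] M0v.
pose P X := linear_subspace (M0 `|` X) /\ ~ (M0 `|` X) v.
have [F FP Ftot|X [[Xs Xv] Xmax]] := @Zorn_bigcup V P.
- split; last by case=> // -[X FX Xv]; have [_] := FP _ FX; apply; right.
  split=> [|k x y]; first by left.
  case=> [Mx|[X FX Xx]] [My|[Y FY Yy]].
  - by left; apply: M0l.
  - have [[_ /(_ k x y (or_introl Mx) (or_intror Yy))[?|?]] _] := FP _ FY;
      by [left|right; exists Y].
  - have [[_ /(_ k x y (or_intror Xx) (or_introl My))[?|?]] _] := FP _ FX;
      by [left|right; exists X].
  - wlog [Z FZ [Zx Zy]] : / exists2 Z, F Z & Z x /\ Z y.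
      have [XY|YX] := Ftot _ _ FX FY; apply.
      + by exists Y => //; split=> //; apply: XY.
      + by exists X => //; split=> //; apply: YX.
    have [[_ /(_ k x y (or_intror Zx) (or_intror Zy))[?|?]] _] := FP _ FZ;
      by [left|right; exists Z].
exists (M0 `|` X); split=> // N Ns XN Nv.
apply: contrapT => NX; apply: (Xmax N).
  split=> [x Xx|NsubX]; first by apply: XN; right.
  by apply: NX => x /NsubX; right.
rewrite /P; suff -> : M0 `|` N = N by [].
by apply/seteqP; split=> [x [Mx|//]|x]; [apply: XN; left|right].
Qed.

(** A subspace M maximal among those avoiding v has codimension one, with v
spanning a complement; the functional is the coefficient along v modulo M. *)
Lemma separating_functional (M0 : set V) v :
  linear_subspace M0 -> ~ M0 v ->
  exists2 f : V -> K, scalar f & f v = 1 /\ forall x, M0 x -> f x = 0.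
Proof.
move=> M0s M0v.
have [M [[M0' Ml] M0M Mv Mmax]] := maximal_subspace_avoiding M0s M0v.
have MN x : M x -> M (- x).
  by move=> Mx; have := Ml (-1) _ _ Mx M0'; rewrite scaleN1r addr0.
have MD x y : M x -> M y -> M (x + y).
  by move=> Mx My; have := Ml 1 _ _ Mx My; rewrite scale1r.
have MZ k x : M x -> M (k *: x).
  by move=> Mx; have := Ml k _ _ Mx M0'; rewrite addr0.
have cover x : exists k, M (x - k *: v).
  (* If x were not in M + K v, then M + K x would be larger and still avoid v. *)
  apply: contrapT => nx.
  pose N : set V := fun y => exists k, M (y - k *: x).
  have Ns : linear_subspace N.
    split; first by exists 0; rewrite scale0r subr0.
    move=> k y z [ky My] [kz Mz]; exists (k * ky + kz).
    have -> : k *: y + z - (k * ky + kz) *: x =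
        k *: (y - ky *: x) + (z - kz *: x).
      by rewrite scalerDl scalerBr scalerA opprD addrACA.
    exact: Ml.
  have MsN : M `<=` N by move=> y My; exists 0; rewrite scale0r subr0.
  have Nx : N x by exists 1; rewrite scale1r subrr.
  have Nv : ~ N v.
    case=> k Mk; have [k0|k0] := eqVneq k 0.
      by apply: Mv; rewrite k0 scale0r subr0 in Mk.
    apply: nx; exists k^-1.
    have := MN _ (MZ k^-1 _ Mk).
    by rewrite scalerBr scalerA mulVf // scale1r opprB.
  by apply: nx; exists 0; rewrite scale0r subr0; apply: (Mmax N).
have uniq x k l : M (x - k *: v) -> M (x - l *: v) -> k = l.
  move=> Mk Ml'; apply/eqP; rewrite -subr_eq0; apply: contrapT => /negP kl.
  apply: Mv; rewrite -[v]scale1r -(mulVf kl) -scalerA; apply: MZ.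
  have -> : (k - l) *: v = (x - l *: v) - (x - k *: v).
    by rewrite opprB scalerBl [RHS]addrC addrA subrK.
  by apply: MD => //; apply: MN.
have [f fP] := choice cover.
exists f => [k x y|].
  apply: (uniq (k *: x + y)) => //=.
  have -> : k *: x + y - (k * f x + f y) *: v =
      k *: (x - f x *: v) + (y - f y *: v).
    by rewrite scalerDl scalerBr scalerA opprD addrACA.
  exact: Ml.
split=> [|x Mx]; apply: (uniq _ _ _ (fP _)).
- by rewrite scale1r subrr.
- by rewrite scale0r subr0; apply: M0M.
Qed.

Lemma functional_eq0 v : (forall f : V -> K, scalar f -> f v = 0) -> v = 0.
Proof.
move=> fv0; apply: contrapT => v0.
have s0 : linear_subspace [set 0].
  by split=> // k x y /= -> ->; rewrite scaler0 addr0.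
have [f fl [fv _]] := separating_functional s0 v0.
by have /eqP := fv0 f fl; rewrite fv oner_eq0.
Qed.

End Functionals.

(** * Slices of tensors *)

Section TensorSlices.
Variable K : fieldType.

Lemma tens0l (U V : lmodType K) (v : V) : (0 : U) ⊗ v = 0.
Proof.
by have := (tens_bilinear U V).1 v (-1) 0 0; rewrite /= scaler0 addr0 scaleN1r addNr.
Qed.
Lemma tensDl (U V : lmodType K) (u u' : U) (v : V) :
  (u + u') ⊗ v = u ⊗ v + u' ⊗ v.
Proof. by have := (tens_bilinear U V).1 v 1 u u'; rewrite /= !scale1r. Qed.
Lemma tensZl (U V : lmodType K) k (u : U) (v : V) : (k *: u) ⊗ v = k *: (u ⊗ v).
Proof. by have := (tens_bilinear U V).1 v k u 0; rewrite /= tens0l !addr0. Qed.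
Lemma tens0r (U V : lmodType K) (u : U) : u ⊗ (0 : V) = 0.
Proof.
by have := (tens_bilinear U V).2 u (-1) 0 0; rewrite /= scaler0 addr0 scaleN1r addNr.
Qed.
Lemma tensDr (U V : lmodType K) (u : U) (v v' : V) :
  u ⊗ (v + v') = u ⊗ v + u ⊗ v'.
Proof. by have := (tens_bilinear U V).2 u 1 v v'; rewrite /= !scale1r. Qed.
Lemma tensZr (U V : lmodType K) k (u : U) (v : V) : u ⊗ (k *: v) = k *: (u ⊗ v).
Proof. by have := (tens_bilinear U V).2 u k v 0; rewrite /= tens0r !addr0. Qed.

Definition tensE := (tensDl, tensZl, tensDr, tensZr).

Section Slices.
Variables U V : lmodType K.

Lemma slice_fst_bilinear (f : U -> K) : scalar f ->
  bilinear_for *:%R *:%R (fun u (v : V) => f u *: v).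
Proof.
move=> fl; split=> [v|u] k x y /=; first by rewrite fl scalerDl scalerA.
by rewrite scalerDr !scalerA mulrC.
Qed.
Lemma slice_fst_linear (f : U -> K) : scalar f -> linear (@slice_fst K U V f).
Proof. by move=> fl; apply/tlift_linear/slice_fst_bilinear. Qed.
Lemma slice_fstE (f : U -> K) u v : scalar f ->
  @slice_fst K U V f (u ⊗ v) = f u *: v.
Proof. by move=> fl; apply/tliftE/slice_fst_bilinear. Qed.

Lemma slice_snd_bilinear (g : V -> K) : scalar g ->
  bilinear_for *:%R *:%R (fun (u : U) v => g v *: u).
Proof.
move=> gl; split=> [v|u] k x y /=; last by rewrite gl scalerDl scalerA.
by rewrite scalerDr !scalerA mulrC.
Qed.
Lemma slice_snd_linear (g : V -> K) : scalar g -> linear (@slice_snd K U V g).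
Proof. by move=> gl; apply/tlift_linear/slice_snd_bilinear. Qed.
Lemma slice_sndE (g : V -> K) u v : scalar g ->
  @slice_snd K U V g (u ⊗ v) = g v *: u.
Proof. by move=> gl; apply/tliftE/slice_snd_bilinear. Qed.

(** The algebraic Fubini theorem: both sides are (f ⊗ g)(t). *)
Lemma slice_fst_snd (f : U -> K) (g : V -> K) t : scalar f -> scalar g ->
  g (slice_fst f t) = f (slice_snd g t).
Proof.
move=> fl gl; move: t.
apply: (@tensor_linear_ext _ _ _ (K^o : lmodType K)) => [k x y|k x y|u v].
- by rewrite slice_fst_linear // gl.
- by rewrite slice_snd_linear // fl.
by rewrite slice_fstE // slice_sndE // !scalarZ // mulrC.
Qed.

Fixpoint seq_span (s : seq V) : set V :=
  if s is v :: s' then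
    (fun x => exists k w, seq_span s' w /\ x = k *: v + w)
  else [set 0]%classic.

Lemma seq_span0 s : seq_span s 0.
Proof. by elim: s => //= v s IHs; exists 0, 0; rewrite scale0r addr0. Qed.

Lemma seq_span_subspace s : linear_subspace (seq_span s).
Proof.
split; first exact: seq_span0.
elim: s => [k x y -> ->|v s IHs k x y /= [kx [wx [sx ->]]] [ky [wy [sy ->]]]].
  by rewrite scaler0 addr0.
exists (k * kx + ky), (k *: wx + wy); split; first exact: IHs.
by rewrite scalerDl scalerDr scalerA addrACA.
Qed.

Lemma seq_span_cons v s x : seq_span s x -> seq_span (v :: s) x.
Proof. by move=> sx; exists 0, x; rewrite scale0r add0r. Qed.

Lemma mem_seq_span v s : v \in s -> seq_span s v.
Proof.
elim: s => // w s IHs; rewrite in_cons => /orP[/eqP->|/IHs].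
  by exists 1, 0; split; [apply: seq_span0|rewrite scale1r addr0].
exact: seq_span_cons.
Qed.

Definition formal_tensor (s : seq (U * V)) : tensor U V :=
  \sum_(p <- s) p.1 ⊗ p.2.

(** The additive structure on tensors is defined on representatives, so a sum of
pure tensors has to be identified with the class of the list of its terms before
a lift can be computed on it. *)
Lemma formal_tensorE s : formal_tensor s = tensor_pi s.
Proof.
apply: tensor_ext => W f hf; rewrite tlift_pi // /formal_tensor.
elim: s => [|p s IHs]; first by rewrite /formal_eval !big_nil; exact: tlift0.
rewrite /formal_eval !big_cons -[p.1 ⊗ p.2]scale1r tlift_linear // tliftE //.
by rewrite scale1r IHs.
Qed.

(** If v is the sum of the k_i v_i, then u ⊗ v is the sum of the k_i u ⊗ v_i, and
these terms merge into the first legs already present. *)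
Lemma absorb_dependent u v (s : seq (U * V)) : seq_span [seq p.2 | p <- s] v ->
  exists2 s', size s' = size s &
    formal_tensor ((u, v) :: s) = formal_tensor s'.
Proof.
rewrite /formal_tensor big_cons /=.
elim: s v => [v /= ->|[u1 v1] s IHs v /= [k [w [/IHs [s' ss' sE] ->]]]].
  by exists [::]; rewrite // tens0r add0r.
exists ((k *: u + u1, v1) :: s'); first by rewrite /= ss'.
rewrite !big_cons -sE /= !tensE !addrA; congr (_ + _).
by rewrite addrAC.
Qed.

(** Functionals on the second leg separate tensors: in an expression of minimal
length every second leg is independent of the others, so a functional can be
chosen that isolates the corresponding first leg. *)
Lemma slice_snd_eq0 (t : tensor U V) :
  (forall g : V -> K, scalar g -> slice_snd g t = 0) -> t = 0.
Proof.
move=> t0.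
have [s tE] : exists s, t = formal_tensor s.
  by exists (tensor_repr t); apply: tensor_sum.
move: t0; rewrite {t}tE; move: {2}(size s) (erefl (size s)) => n.
elim: n s => [|n IHn] [|[u v] s] //= => [_ _|[ssz] s0].
  by rewrite /formal_tensor big_nil.
have [vs|vs] := pselect (seq_span [seq p.2 | p <- s] v).
  have [s' ss' sE] := absorb_dependent u vs.
  by rewrite sE; apply: IHn => [|g gl]; rewrite ?ss' // -sE; apply: s0.
have [g gl [gv gs]] := separating_functional (seq_span_subspace _) vs.
have us : formal_tensor ((u, v) :: s) = u ⊗ v + formal_tensor s.
  by rewrite /formal_tensor big_cons.
have u0 : u = 0.
  have := s0 g gl.
  rewrite us -[u ⊗ v]scale1r slice_snd_linear // slice_sndE // gv !scale1r.
  suff -> : slice_snd g (formal_tensor s) = 0 by rewrite addr0.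
  rewrite /slice_snd formal_tensorE tlift_pi; last exact: slice_snd_bilinear.
  rewrite /formal_eval big_seq big1 // => p ps.
  by rewrite gs ?scale0r //; apply/mem_seq_span/map_f.
have {}us : formal_tensor ((u, v) :: s) = formal_tensor s.
  by rewrite us u0 tens0l add0r.
by rewrite us; apply: IHn => // h hl; rewrite -us; apply: s0.
Qed.

End Slices.
End TensorSlices.

(** * Non-degeneracy of tensor products and multipliers *)

Section TensorMapFacts.
Variable K : fieldType.

Lemma id_is_linear (V : lmodType K) : linear (@id V).
Proof. by []. Qed.

Lemma tmap_comp (U V U' V' U'' V'' : lmodType K)
    (f : U -> U') (g : V -> V') (f' : U' -> U'') (g' : V' -> V'') t :
  linear f -> linear g -> linear f' -> linear g' ->
  tmap f' g' (tmap f g t) = tmap (f' \o f) (g' \o g) t.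
Proof.
move=> hf hg hf' hg'; move: t.
have hf'f : linear (f' \o f) by move=> k x y /=; rewrite hf hf'.
have hg'g : linear (g' \o g) by move=> k x y /=; rewrite hg hg'.
by apply: tensor_linear_ext => [k x y|k x y|u v]; rewrite ?tmap_linear // !tmapE.
Qed.

Lemma tmap_linear_r (U V U' V' : lmodType K) (f : U -> U') (g h : V -> V') k t :
  linear f -> linear g -> linear h ->
  tmap f (fun v => k *: g v + h v) t = k *: tmap f g t + tmap f h t.
Proof.
move=> hf hg hh; move: t.
have hgh : linear (fun v => k *: g v + h v).
  exact: linear_comb.
apply: tensor_linear_ext => [|l x y|u v]; first exact: tmap_linear.
  by rewrite !tmap_linear // !scalerDr !scalerA mulrC addrACA.
by rewrite !tmapE // tensDr tensZr.
Qed.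

Lemma tmap_linear_l (U V U' V' : lmodType K) (f g : U -> U') (h : V -> V') k t :
  linear f -> linear g -> linear h ->
  tmap (fun u => k *: f u + g u) h t = k *: tmap f h t + tmap g h t.
Proof.
move=> hf hg hh; move: t.
have hfg : linear (fun v => k *: f v + g v).
  exact: linear_comb.
apply: tensor_linear_ext => [|l x y|u v]; first exact: tmap_linear.
  by rewrite !tmap_linear // !scalerDr !scalerA mulrC addrACA.
by rewrite !tmapE // tensDl tensZl.
Qed.

Lemma slice_fst_tmap (U V U' V' : lmodType K) (f : U -> U') (g : V -> V')
    (w : U' -> K) t :
  linear f -> linear g -> scalar w ->
  slice_fst w (tmap f g t) = g (slice_fst (w \o f) t).
Proof.
move=> hf hg hw; move: t.
have hwf : scalar (w \o f) by move=> k x y /=; rewrite hf hw.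
apply: tensor_linear_ext => [k x y|k x y|u v].
- by rewrite tmap_linear // slice_fst_linear.
- by rewrite slice_fst_linear // hg.
by rewrite tmapE // !slice_fstE // (scalable_linear hg).
Qed.

Lemma slice_snd_tmap (U V U' V' : lmodType K) (f : U -> U') (g : V -> V')
    (w : V' -> K) t :
  linear f -> linear g -> scalar w ->
  slice_snd w (tmap f g t) = f (slice_snd (w \o g) t).
Proof.
move=> hf hg hw; move: t.
have hwg : scalar (w \o g) by move=> k x y /=; rewrite hg hw.
apply: tensor_linear_ext => [k x y|k x y|u v].
- by rewrite tmap_linear // slice_snd_linear.
- by rewrite slice_snd_linear // hf.
by rewrite tmapE // !slice_sndE // (scalable_linear hf).
Qed.

Lemma nmul_tmap_l (A B : nalgType K) (a : A) (b : B) t :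
  (a ⊗ b) ∙ t = tmap (nmul a) (nmul b) t.
Proof. by rewrite -[LHS]/(tmul _ _) [LHS]tliftE //; exact: tmul_bilinear_subproof. Qed.

Lemma nmul_tmap_r (A B : nalgType K) (a : A) (b : B) t :
  t ∙ (a ⊗ b) = tmap (nmul^~ a) (nmul^~ b) t.
Proof.
move: t; apply: tensor_linear_ext => [k x y|k x y|u v].
- exact: nmul_linl.
- by apply: tmap_linear; apply: nmul_linl.
by rewrite nmul_tens tmapE //; apply: nmul_linl.
Qed.

Lemma nondegenerate_tensor (A B : nalgType K) :
  Defs.nondegenerate A -> Defs.nondegenerate B ->
  Defs.nondegenerate (tensor A B).
Proof.
(* With M_c and N_d multiplication by c and d on one fixed side, t is killed by
all M_c ⊗ N_d; slicing strips the two legs one at a time. *)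
have strip (M : A -> A -> A) (N : B -> B -> B) (t : tensor A B) :
    (forall c, linear (M c)) -> (forall d, linear (N d)) ->
    (forall a, (forall c, M c a = 0) -> a = 0) ->
    (forall b, (forall d, N d b = 0) -> b = 0) ->
    (forall c d, tmap (M c) (N d) t = 0) -> t = 0.
  move=> Ml Nl M0 N0 t0.
  have stripA d : tmap id (N d) t = 0.
    apply: slice_snd_eq0 => g gl; apply: M0 => c.
    rewrite -(slice_snd_tmap _ (Ml c) (@id_is_linear B) gl) tmap_comp //.
    by rewrite t0 linear0 //; apply: slice_snd_linear.
  have sliceB f : scalar f -> slice_fst f t = 0.
    move=> fl; apply: N0 => d.
    rewrite -(slice_fst_tmap _ (@id_is_linear A) (Nl d) fl) stripA linear0 //.
    exact: slice_fst_linear.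
  apply: slice_snd_eq0 => g gl; apply: functional_eq0 => f fl.
  by rewrite -slice_fst_snd // sliceB // (linear0 (gl : linear (g : B -> K^o))).
move=> [Al Ar] [Bl Br]; split=> t t0.
- apply: (strip (fun c => nmul^~ c) (fun d => nmul^~ d)) => //.
  + by move=> c; apply: nmul_linl.
  + by move=> c; apply: nmul_linl.
  + by move=> c d; rewrite -nmul_tmap_r t0.
- apply: (strip (@nmul _ A) (@nmul _ B)) => //.
  + by move=> c; apply: nmul_linr.
  + by move=> c; apply: nmul_linr.
  + by move=> c d; rewrite -nmul_tmap_l t0.
Qed.

Section Multipliers.
Variable A : nalgType K.
Implicit Types (m n : multiplier A) (a b : A).

Lemma memb_linear : linear (@memb K A).
Proof.
by move=> k a b; apply: multiplier_ext => c /=; rewrite ?nmul_linl ?nmul_linr.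
Qed.

Lemma mone_nmul m : mone ∙ m = m.
Proof. exact: multiplier_ext. Qed.

Lemma nmul_mone m : m ∙ mone = m.
Proof. exact: multiplier_ext. Qed.

Hypothesis nd : Defs.nondegenerate A.

Lemma nmul_injr a b : (forall c, a ∙ c = b ∙ c) -> a = b.
Proof.
move=> ab; apply/eqP; rewrite -subr_eq0; apply/eqP/nd.1 => c.
by rewrite nmulDl ab -nmulDl subrr nmul0l.
Qed.

Lemma nmul_injl a b : (forall c, c ∙ a = c ∙ b) -> a = b.
Proof.
move=> ab; apply/eqP; rewrite -subr_eq0; apply/eqP/nd.2 => c.
by rewrite nmulDr ab -nmulDr subrr nmul0r.
Qed.

Lemma memb_inj : injective (@memb K A).
Proof.
move=> a b /(congr1 (@mull _ _)) ab.
by apply: nmul_injr => c; apply: (congr1 (@^~ c) ab).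
Qed.

(** The left action of a multiplier commutes with right multiplication although
only the compatibility of its two actions is required: the two sides agree after
multiplication on the left. *)
Lemma mull_nmul m a b : mull m (a ∙ b) = mull m a ∙ b.
Proof. by apply: nmul_injl => c; rewrite -mulr_mull !nmulA mulr_mull. Qed.

Lemma mulr_nmul m a b : mulr m (a ∙ b) = a ∙ mulr m b.
Proof. by apply: nmul_injr => c; rewrite mulr_mull -!nmulA mulr_mull. Qed.

Lemma memb_mull m a : memb (mull m a) = m ∙ memb a.
Proof.
apply: multiplier_ext => c /=; first by rewrite mull_nmul.
by rewrite mulr_mull.
Qed.

Lemma memb_mulr m a : memb (mulr m a) = memb a ∙ m.
Proof.
apply: multiplier_ext => c /=; last by rewrite mulr_nmul.
by rewrite mulr_mull.
Qed.

End Multipliers.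

Section MtensFacts.
Variables A B : nalgType K.

Lemma mtens_nmul (m m' : multiplier A) (n n' : multiplier B) :
  mtens m n ∙ mtens m' n' = mtens (m ∙ m') (n ∙ n').
Proof.
apply: multiplier_ext => t /=.
- by rewrite tmap_comp //; apply: mull_linear.
- by rewrite tmap_comp //; apply: mulr_linear.
Qed.

Lemma mtens_comm (m : multiplier A) (n : multiplier B) :
  mtens m mone ∙ mtens mone n = mtens mone n ∙ mtens m mone.
Proof. by rewrite !mtens_nmul !mone_nmul !nmul_mone. Qed.

Lemma memb_tens (a : A) (b : B) : memb (a ⊗ b) = mtens (memb a) (memb b).
Proof.
by apply: multiplier_ext => t /=; rewrite ?nmul_tmap_l ?nmul_tmap_r.
Qed.

Lemma mtens_linear_r (m : multiplier A) k (x y : multiplier B) :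
  mtens m (k *: x + y) = k *: mtens m x + mtens m y.
Proof.
by apply: multiplier_ext => t /=; apply: tmap_linear_r;
  first [exact: mull_linear | exact: mulr_linear].
Qed.

Lemma mtens_linear_l (n : multiplier B) k (x y : multiplier A) :
  mtens (k *: x + y) n = k *: mtens x n + mtens y n.
Proof.
by apply: multiplier_ext => t /=; apply: tmap_linear_l;
  first [exact: mull_linear | exact: mulr_linear].
Qed.

Lemma mull_mtens (m : multiplier A) (n : multiplier B) u v :
  mull (mtens m n) (u ⊗ v) = mull m u ⊗ mull n v.
Proof. by apply: tmapE; apply: mull_linear. Qed.

Hypotheses (ndA : Defs.nondegenerate A) (ndB : Defs.nondegenerate B).
Let nd := nondegenerate_tensor ndA ndB.

Lemma memb_mulr_fst (a : A) (t : tensor A B) :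
  memb (tmap (nmul^~ a) id t) = memb t ∙ mtens (memb a) mone.
Proof. exact: (memb_mulr nd (mtens (memb a) mone) t). Qed.

Lemma memb_mull_fst (a : A) (t : tensor A B) :
  memb (tmap (nmul a) id t) = mtens (memb a) mone ∙ memb t.
Proof. exact: (memb_mull nd (mtens (memb a) mone) t). Qed.

Lemma memb_mulr_snd (b : B) (t : tensor A B) :
  memb (tmap id (nmul^~ b) t) = memb t ∙ mtens mone (memb b).
Proof. exact: (memb_mulr nd (mtens mone (memb b)) t). Qed.

Lemma memb_mull_snd (b : B) (t : tensor A B) :
  memb (tmap id (nmul b) t) = mtens mone (memb b) ∙ memb t.
Proof. exact: (memb_mull nd (mtens mone (memb b)) t). Qed.

End MtensFacts.
End TensorMapFacts.

(** * The associator *)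

Section Tassociator.
Variable K : fieldType.

Section Tassoc.
Variables U V W : lmodType K.

Lemma tassoc_inner_bilinear (w : W) :
  bilinear_for *:%R *:%R (fun (u : U) (v : V) => u ⊗ (v ⊗ w)).
Proof. by split=> [v|u] k x y; rewrite !tensE. Qed.

Lemma tassoc_bilinear : bilinear_for *:%R *:%R
  (fun t (w : W) => tlift (fun (u : U) (v : V) => u ⊗ (v ⊗ w)) t).
Proof.
split=> [w|t] k x y; first exact/tlift_linear/tassoc_inner_bilinear.
have hl z := tlift_linear (tassoc_inner_bilinear z).
move: t; apply: tensor_linear_ext => [||u v]; first exact: hl.
  exact: linear_comb.
by rewrite !tliftE ?tensE //; apply: tassoc_inner_bilinear.
Qed.

Lemma tassoc_linear : linear (@tassoc K U V W).
Proof. exact/tlift_linear/tassoc_bilinear. Qed.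

Lemma tassocE u v w : @tassoc K U V W ((u ⊗ v) ⊗ w) = u ⊗ (v ⊗ w).
Proof.
rewrite /tassoc tliftE; last exact: tassoc_bilinear.
by rewrite tliftE //; apply: tassoc_inner_bilinear.
Qed.

End Tassoc.

Lemma tassoc_nmul (A B C : nalgType K) (t : tensor A B) (w k : C) (g : A) (h : B) :
  tassoc (t ⊗ w) ∙ (g ⊗ (h ⊗ k)) = tassoc ((t ∙ (g ⊗ h)) ⊗ (w ∙ k)).
Proof.
move: t; apply: tensor_linear_ext => [l x y|l x y|u v].
- by rewrite tensE tensE tassoc_linear nmul_linl.
- by rewrite nmul_linl tensE tensE tassoc_linear.
by rewrite tassocE !nmul_tens tassocE.
Qed.

End Tassociator.

(** * Covered coproducts and coassociativity *)

Section Covers.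
Variables (K : numClosedFieldType) (A : multHopfStarAlg K).
Variable eps : A -> K.
Hypothesis eps_counit : is_counit eps.
Local Notation Delta := (@comul K A).

Let nd : Defs.nondegenerate A := @mhs_nondegenerate K A.
Let nd2 : Defs.nondegenerate (tensor A A) := nondegenerate_tensor nd nd.
Let memb_inj2 := memb_inj nd2.

(** The element Δ(a)(1 ⊗ b) of A ⊗ A. *)
Definition comul_1r (a b : A) : tensor A A :=
  xget 0 [set t | memb t = Delta a ∙ mtens mone (memb b)]%classic.

(** The element Δ(a)(b ⊗ 1) of A ⊗ A. *)
Definition comul_r1 (a b : A) : tensor A A :=
  xget 0 [set t | memb t = Delta a ∙ mtens (memb b) mone]%classic.

(** The defining property of the counit slices Δ(a) covered on either side, and
so contains the existence of all covered coproducts. *)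
Lemma memb_comul_1r a b : memb (comul_1r a b) = Delta a ∙ mtens mone (memb b).
Proof.
have [_ _ _ /(_ a b)[[t [tE _]] _] _] := eps_counit.
exact: (xgetI 0 (tE : [set t | memb t = Delta a ∙ mtens mone (memb b)]%classic t)).
Qed.

Lemma memb_comul_r1 a b : memb (comul_r1 a b) = Delta a ∙ mtens (memb b) mone.
Proof.
have [_ _ _ _ /(_ a b)[[t [tE _]] _]] := eps_counit.
exact: (xgetI 0 (tE : [set t | memb t = Delta a ∙ mtens (memb b) mone]%classic t)).
Qed.

Lemma comul_1r_eq a b t :
  memb t = Delta a ∙ mtens mone (memb b) -> t = comul_1r a b.
Proof. by rewrite -memb_comul_1r; apply: memb_inj2. Qed.

Lemma comul_r1_eq a b t :
  memb t = Delta a ∙ mtens (memb b) mone -> t = comul_r1 a b.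
Proof. by rewrite -memb_comul_r1; apply: memb_inj2. Qed.

Let Delta_linear : linear Delta. Proof. by have [] := @comul_star_hom K A. Qed.
Let Delta_mul a b : Delta (a ∙ b) = Delta a ∙ Delta b.
Proof. by have [] := @comul_star_hom K A. Qed.

Lemma comul_1r_bilinear : bilinear_for *:%R *:%R comul_1r.
Proof.
split=> [b|a] k x y; apply: memb_inj2; rewrite memb_linear !memb_comul_1r.
  by rewrite Delta_linear nmul_linl.
by rewrite memb_linear mtens_linear_r nmul_linr.
Qed.

Lemma comul_r1_linear b : linear (comul_r1^~ b).
Proof.
move=> k x y; apply: memb_inj2; rewrite memb_linear !memb_comul_r1.
by rewrite Delta_linear nmul_linl.
Qed.

Lemma comul_1r_nmul a b s :
  comul_1r a b ∙ s = mull (Delta a) (tmap id (nmul b) s).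
Proof. exact: (congr1 (fun m => mull m s) (memb_comul_1r a b)). Qed.

Lemma comul_r1_nmul a b s :
  comul_r1 a b ∙ s = mull (Delta a) (tmap (nmul b) id s).
Proof. exact: (congr1 (fun m => mull m s) (memb_comul_r1 a b)). Qed.

(** The extensions of Δ ⊗ ι and ι ⊗ Δ to multipliers are prescribed through products
Δ(a)(u ⊗ w) in A ⊗ A; this brings them back to covered coproducts. *)
Lemma comul_tens a u w :
  mull (Delta a) (u ⊗ w) = tmap (nmul^~ u) id (comul_1r a w).
Proof.
apply: memb_inj2.
rewrite memb_mulr_fst // memb_comul_1r memb_mull // -nmulA -mtens_comm memb_tens mtens_nmul.
by rewrite mone_nmul nmul_mone.
Qed.

Lemma comul_span_ext (W : lmodType K) (f g : tensor A A -> W) :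
  linear f -> linear g ->
  (forall u t, f (mull (Delta u) t) = g (mull (Delta u) t)) -> f =1 g.
Proof.
move=> fl gl fg t; have [s ->] := @comul_nondegenerate K A t.
by apply: linear_sum_ext => // p; apply: fg.
Qed.

Lemma Delta_tens_id_bilinear :
  bilinear_for *:%R *:%R (fun a (b : A) => mtens (Delta a) (memb b)).
Proof.
split=> [b|a] k x y; first by rewrite Delta_linear mtens_linear_l.
by rewrite memb_linear mtens_linear_r.
Qed.

Lemma id_tens_Delta_bilinear :
  bilinear_for *:%R *:%R (fun (a : A) b => mtens (memb a) (Delta b)).
Proof.
split=> [b|a] k x y; first by rewrite memb_linear mtens_linear_l.
by rewrite Delta_linear mtens_linear_r.
Qed.

Lemma Delta_tens_idE a b : Delta_tens_id Delta (a ⊗ b) = mtens (Delta a) (memb b).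
Proof. exact/tliftE/Delta_tens_id_bilinear. Qed.

Lemma id_tens_DeltaE a b : id_tens_Delta Delta (a ⊗ b) = mtens (memb a) (Delta b).
Proof. exact/tliftE/id_tens_Delta_bilinear. Qed.

Lemma Delta_tens_id_linear : linear (Delta_tens_id Delta).
Proof. exact/tlift_linear/Delta_tens_id_bilinear. Qed.

Lemma id_tens_Delta_linear : linear (id_tens_Delta Delta).
Proof. exact/tlift_linear/id_tens_Delta_bilinear. Qed.

(** (Δ ⊗ ι)(Δ(c)) (1 ⊗ 1 ⊗ w) = (Δ ⊗ ι)(Δ(c)(1 ⊗ w)). The extension of Δ ⊗ ι is
only prescribed on its products with (Δ ⊗ ι)(u ⊗ w), which is enough because
Δ(A)(A ⊗ A) = A ⊗ A. *)
Lemma extension_Delta_tens_id c n1 w t k :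
  is_extension_at (Delta_tens_id Delta) (Delta c) n1 ->
  mull n1 (t ⊗ (w ∙ k)) = mull (Delta_tens_id Delta (comul_1r c w)) (t ⊗ k).
Proof.
move=> n1E; move: t; apply: comul_span_ext => [l x y|l x y|u t].
- by rewrite tensDl tensZl mull_linear.
- by rewrite tensDl tensZl mull_linear.
have := congr1 (fun m => mull m (t ⊗ k)) (n1E (u ⊗ w)).1.
rewrite /= Delta_tens_idE mull_mtens /= => ->; rewrite comul_tens.
move: (comul_1r c w); apply: tensor_linear_ext => [l x y|l x y|v w'].
- by rewrite tmap_linear ?Delta_tens_id_linear //; apply: nmul_linl.
- by rewrite Delta_tens_id_linear.
rewrite tmapE //; last exact: nmul_linl.
by rewrite !Delta_tens_idE !mull_mtens Delta_mul.
Qed.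

(** (ι ⊗ Δ)(Δ(c)) (1 ⊗ Δ(x)) = (ι ⊗ Δ)(Δ(c)(1 ⊗ x)). Here the first leg g' comes
from covering Δ(c)(g' ⊗ x), whence the products g' g as test elements. *)
Lemma extension_id_tens_Delta c n2 x t g g' :
  is_extension_at (id_tens_Delta Delta) (Delta c) n2 ->
  mull n2 ((g' ∙ g) ⊗ mull (Delta x) t) =
  mull (id_tens_Delta Delta (comul_1r c x)) ((g' ∙ g) ⊗ t).
Proof.
move=> n2E.
have := congr1 (fun m => mull m (g ⊗ t)) (n2E (g' ⊗ x)).1.
rewrite /= id_tens_DeltaE mull_mtens /= => ->; rewrite comul_tens.
move: (comul_1r c x); apply: tensor_linear_ext => [l y z|l y z|v w'].
- by rewrite tmap_linear ?id_tens_Delta_linear //; apply: nmul_linl.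
- by rewrite id_tens_Delta_linear.
rewrite tmapE //; last exact: nmul_linl.
by rewrite !id_tens_DeltaE !mull_mtens /= nmulA.
Qed.

Let comul_1r_linl b := comul_1r_bilinear.1 b.
Let comul_1r_linr a := comul_1r_bilinear.2 a.

Lemma regrouped_bilinear c : bilinear_for *:%R *:%R
  (fun e f => tassoc (tmap (comul_1r^~ e) id (comul_1r c f))).
Proof.
split=> [f|e] k x y.
- rewrite -tassoc_linear -tmap_linear_l //.
  by congr (tassoc (tmap _ _ _)); apply/funext => v; apply: comul_1r_linr.
- by rewrite comul_1r_linr tmap_linear // tassoc_linear.
Qed.

(** Both sides are (ι ⊗ Δ)Δ(c) multiplied on the right by 1 ⊗ Δ(x)(d ⊗ 1), that is
c_(1) ⊗ c_(2) x_(1) d ⊗ c_(3) x_(2): the left one multiplies c_(2) by x before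
applying Δ to it, the right one applies Δ to the first leg of Δ(c)(1 ⊗ f), with e
and f the legs of Δ(x)(d ⊗ 1). *)
Lemma coassoc_covered c x d :
  tmap id (comul_r1^~ d) (comul_1r c x) =
  tlift (fun e f => tassoc (tmap (comul_1r^~ e) id (comul_1r c f)))
    (comul_r1 x d).
Proof.
have [n1 [n2 [n1E n2E n12 _]]] := @comul_coassoc K A c.
have nd3 := nondegenerate_tensor nd nd2.
have test (X Y : tensor A (tensor A A)) :
    (forall g' g h k, X ∙ ((g' ∙ g) ⊗ (h ⊗ k)) = Y ∙ ((g' ∙ g) ⊗ (h ⊗ k))) ->
    X = Y.
  move=> XY; apply: (nmul_injr nd3) => s; apply: (nmul_injr nd3) => r.
  rewrite -!nmulA; move: s.
  apply: tensor_linear_ext => [l y z|l y z|g' s]; rewrite ?nmul_linl ?nmul_linr //.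
  move: r; apply: tensor_linear_ext => [l y z|l y z|g r]; rewrite ?nmul_linr //.
  rewrite !nmul_tens; move: (s ∙ r).
  apply: tensor_linear_ext => [l y z|l y z|h k]; last exact: XY.
  - by rewrite tensDr tensZr nmul_linr.
  - by rewrite tensDr tensZr nmul_linr.
apply: test => g' g h k.
have -> : tmap id (comul_r1^~ d) (comul_1r c x) ∙ ((g' ∙ g) ⊗ (h ⊗ k)) =
    mull n2 ((g' ∙ g) ⊗ (comul_r1 x d ∙ (h ⊗ k))).
  rewrite comul_r1_nmul (extension_id_tens_Delta _ _ _ _ n2E).
  move: (comul_1r c x); apply: tensor_linear_ext => [l y z|l y z|r s].
  - by rewrite tmap_linear ?nmul_linl //; apply: comul_r1_linear.
  - by rewrite id_tens_Delta_linear.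
  rewrite tmapE //; last exact: comul_r1_linear.
  by rewrite nmul_tens id_tens_DeltaE mull_mtens comul_r1_nmul.
move: (comul_r1 x d); apply: tensor_linear_ext => [l y z|l y z|e f].
- by rewrite nmul_linl tensDr tensZr mull_linear.
- by rewrite tlift_linear ?nmul_linl //; apply: regrouped_bilinear.
rewrite tliftE; last exact: regrouped_bilinear.
rewrite nmul_tens -(tassocE _ (e ∙ h)) -n12 (extension_Delta_tens_id _ _ _ n1E).
move: (comul_1r c f); apply: tensor_linear_ext => [l y z|l y z|v w].
- by rewrite Delta_tens_id_linear -tassoc_linear.
- by rewrite tmap_linear // tassoc_linear nmul_linl.
rewrite Delta_tens_idE mull_mtens tmapE // tassoc_nmul comul_1r_nmul.
by rewrite tmapE //; apply: nmul_linr.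
Qed.

End Covers.

Arguments comul_1r {K A}.
Arguments comul_r1 {K A}.

(** * Strong left invariance *)

Section StrongInvariance.
Variables (K : numClosedFieldType) (A : multHopfStarAlg K).
Variables (S : A -> A) (phi : A -> K).
Hypotheses (S_antipode : is_antipode S) (phi_left : left_integral phi).

Let nd : Defs.nondegenerate A := @mhs_nondegenerate K A.
Let nd2 : Defs.nondegenerate (tensor A A) := nondegenerate_tensor nd nd.
Let phi_linear : scalar phi. Proof. by case: phi_left. Qed.
Let S_linear : linear S. Proof. by case: S_antipode. Qed.

Lemma antipode_slice_bilinear : bilinear_for *:%R *:%R
  (fun r (t : tensor A A) => S r ∙ slice_snd phi t).
Proof.
split=> [t|r] k x y /=; first by rewrite S_linear nmul_linl.
by rewrite slice_snd_linear // nmul_linr.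
Qed.

Lemma antipode_mul_bilinear : bilinear_for *:%R *:%R (fun u v : A => S u ∙ v).
Proof.
by split=> [t|r] k x y /=; rewrite ?S_linear ?nmul_linl // nmul_linr.
Qed.

(** S(c_(1)) φ(c_(2) x) = x_(1) φ(c x_(2)). After multiplication by d on the right,
both sides are the image under Theta : r ⊗ s ⊗ t |-> S(r) s φ(t) of the element
c_(1) ⊗ c_(2) x_(1) d ⊗ c_(3) x_(2). *)
Lemma strong_left_invariance c x t :
  memb t = mtens mone (memb c) ∙ comul x ->
  S (slice_snd phi (comul_1r c x)) = slice_snd phi t.
Proof.
move=> tE; apply: (nmul_injr nd) => d.
have [_ _ _ _ [eps [eps_counit S_eps _]]] := S_antipode.
pose Theta : tensor A (tensor A A) -> A :=
  tlift (fun r t => S r ∙ slice_snd phi t).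
have ThetaL : linear Theta by apply/tlift_linear/antipode_slice_bilinear.
have ThetaE r s : Theta (r ⊗ s) = S r ∙ slice_snd phi s.
  exact/tliftE/antipode_slice_bilinear.
have /(congr1 Theta) := coassoc_covered eps_counit c x d.
(* Left invariance removes the coproduct of the second leg. *)
have -> T : Theta (tmap id (comul_r1^~ d) T) = S (slice_snd phi T) ∙ d.
  have r1L := comul_r1_linear eps_counit d.
  move: T; apply: tensor_linear_ext => [k y z|k y z|r s].
  - by rewrite tmap_linear // ThetaL.
  - by rewrite slice_snd_linear // S_linear nmul_linl.
  rewrite tmapE // ThetaE slice_sndE // (scalable_linear S_linear) nmulZl.
  have [_ _ /(_ s d)[[r1 [r1E phi_r1]] _]] := phi_left.
  by rewrite -(comul_r1_eq eps_counit r1E) -phi_r1 nmulZr.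
move=> ->.
(* The antipode identity removes the coproduct of the first leg. *)
have Theta_assoc X w : Theta (tassoc (X ⊗ w)) =
    phi w *: tlift (fun u v => S u ∙ v) X.
  move: X; apply: tensor_linear_ext => [k y z|k y z|u v].
  - by rewrite tensDl tensZl tassoc_linear ThetaL.
  - rewrite tlift_linear ?scalerDr ?scalerA ?[_ * k]mulrC //.
    exact: antipode_mul_bilinear.
  rewrite tassocE ThetaE slice_sndE // tliftE ?nmulZr //.
  exact: antipode_mul_bilinear.
have Theta_regrouped e f :
    Theta (tassoc (tmap (comul_1r^~ e) id (comul_1r c f))) = phi (c ∙ f) *: e.
  have [epsL _ _ /(_ c f)[[t1 [t1E eps_t1]] _] _] := eps_counit.
  rewrite (comul_1r_eq eps_counit t1E) in eps_t1.
  rewrite -[c ∙ f]/(mull (memb c) f) eps_t1.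
  have rL := (comul_1r_bilinear eps_counit).1 e.
  move: (comul_1r c f); apply: tensor_linear_ext => [k y z|k y z|v w].
  - by rewrite tmap_linear // tassoc_linear ThetaL.
  - by rewrite slice_fst_linear // phi_linear scalerDl scalerA.
  rewrite tmapE // Theta_assoc slice_fstE // scalarZ //.
  by rewrite (S_eps v e) ?scalerA 1?mulrC //; apply: memb_comul_1r eps_counit _ _.
transitivity (slice_snd phi (tmap id (nmul c) (comul_r1 x d))).
  move: (comul_r1 x d); apply: tensor_linear_ext => [k y z|k y z|e f].
  - by rewrite tlift_linear ?ThetaL //; apply: regrouped_bilinear eps_counit _.
  - by rewrite tmap_linear // ?slice_snd_linear //; apply: nmul_linr.
  rewrite tliftE; last exact: regrouped_bilinear eps_counit _.
  by rewrite Theta_regrouped tmapE ?slice_sndE //; apply: nmul_linr.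
have <- : tmap (nmul^~ d) id t = tmap id (nmul c) (comul_r1 x d).
  apply: (memb_inj nd2).
  rewrite memb_mulr_fst // memb_mull_snd // tE (memb_comul_r1 eps_counit).
  by rewrite nmulA.
by rewrite slice_snd_tmap //; apply: nmul_linl.
Qed.

End StrongInvariance.

(** * Slices by covered functionals *)

Section CoveredFunctionals.
Variables (K : numClosedFieldType) (A : multHopfStarAlg K).
Variable eps : A -> K.
Hypothesis eps_counit : is_counit eps.

Let nd : Defs.nondegenerate A := @mhs_nondegenerate K A.
Let memb_inj2 := memb_inj (nondegenerate_tensor nd nd).

(** If e stands for the multiplication by an element that covers the first leg,
and t for the coproduct of x covered in this way, then the slice of the coproduct
of x by g \o e is the slice of t by g, an element of A. *)
Lemma sweedler_fst_slice (g : A -> K) (e : A -> A) x t :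
  scalar g -> linear e ->
  (forall d t1, memb t1 = comul x ∙ mtens mone (memb d) ->
     tmap id (nmul^~ d) t = tmap e id t1) ->
  (forall d t2, memb t2 = mtens mone (memb d) ∙ comul x ->
     tmap id (nmul d) t = tmap e id t2) ->
  is_slice_fst (g \o e) (comul x) (memb (sweedler_fst (g \o e) x)).
Proof.
move=> gl el tr tl.
apply: (xgetI 0 (_ : [set z | is_slice_fst _ _ (memb z)]%classic (slice_fst g t))).
have [_ _ _ /(_ x) cover _] := eps_counit.
move=> d; have [[t1 [t1E _]] [t2 [t2E _]]] := cover d.
split; [exists t1|exists t2]; split=> //=.
- have := congr1 (slice_fst g) (tr d t1 t1E).
  by rewrite !slice_fst_tmap //; apply: nmul_linl.
- have := congr1 (slice_fst g) (tl d t2 t2E).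
  by rewrite !slice_fst_tmap //; apply: nmul_linr.
Qed.

Lemma sweedler_fst_coveredr (g : A -> K) y x : scalar g ->
  is_slice_fst (fun u => g (u ∙ y)) (comul x)
    (memb (sweedler_fst (fun u => g (u ∙ y)) x)).
Proof.
move=> gl; have [_ _ _ _ /(_ x y)[[t [tE _]] _]] := eps_counit.
apply: (sweedler_fst_slice (t := t)) => // [|d t1 t1E|d t2 t2E].
- exact: nmul_linl.
- apply: memb_inj2; rewrite memb_mulr_snd // memb_mulr_fst // tE t1E -!nmulA.
  by rewrite mtens_comm.
- apply: memb_inj2; rewrite memb_mull_snd // memb_mulr_fst // tE t2E.
  by rewrite nmulA.
Qed.

Lemma sweedler_fst_coveredl (g : A -> K) y x : scalar g ->
  is_slice_fst (fun u => g (y ∙ u)) (comul x)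
    (memb (sweedler_fst (fun u => g (y ∙ u)) x)).
Proof.
move=> gl; have [_ _ _ _ /(_ x y)[_ [t [tE _]]]] := eps_counit.
apply: (sweedler_fst_slice (t := t)) => // [|d t1 t1E|d t2 t2E].
- exact: nmul_linr.
- apply: memb_inj2; rewrite memb_mulr_snd // memb_mull_fst // tE t1E.
  by rewrite nmulA.
- apply: memb_inj2; rewrite memb_mull_snd // memb_mull_fst // tE t2E !nmulA.
  by rewrite mtens_comm.
Qed.

End CoveredFunctionals.

(** * The Fourier transform intertwines the two actions *)

Theorem proposition3p5 (R : realType) (A : multHopfStarAlg R[i])
    (S Sinv : A -> A) (S_antipode : is_antipode S)
    (SK : cancel S Sinv) (SinvK : cancel Sinv S)
    (phi : A -> R[i]) (phi_left : left_integral phi)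
    (phi_pos : positive_functional phi)
    (psi_ex : exists psi : A -> R[i], right_integral psi /\ positive_functional psi)
    (B : multHopfStarAlg R[i]) (pr : A -> B -> R[i])
    (B_dual : is_op_dual S phi pr)
    (F : A -> B) (F_fourier : forall c x : A, pr c (F x) = phi (c ∙ x)) :
  forall (a x : A) (b : B),
    F (op_pi a x) = lambda_on_B pr a (F x) /\
    F (lambda_on_A pr Sinv b x) = op_pi b (F x).
Proof.
move=> a x b; split; apply: (dual_inj B_dual) => c.
  by rewrite /lambda_on_B -(dual_comul B_dual) !F_fourier /op_pi nmulA.
have [Sl _ Smul _ [eps [eps_counit _ _]]] := S_antipode.
have [phil _ _] := phi_left.
have [y _ prb] : range (fun (x : A) (a : A) => phi (a ∙ x)) (pr^~ b).
  by rewrite -(dual_range B_dual); exists b.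
have Sinvl : linear Sinv.
  by move=> k u v; apply: (can_inj SK); rewrite SinvK Sl !SinvK.
(* S^-1 is anti-multiplicative, so y on the right becomes S(y) on the left, where
it covers the first leg of the coproduct of x. *)
have Sinv_cov u : Sinv u ∙ y = Sinv (S y ∙ u).
  by apply: (can_inj SK); rewrite Smul !SinvK.
have gl : scalar (phi \o Sinv) by move=> k u v; rewrite /= Sinvl phil.
have fE : (fun u => pr (Sinv u) b) = (fun u => (phi \o Sinv) (S y ∙ u)).
  by apply/funext => u; rewrite /= -Sinv_cov -[LHS]/((pr^~ b) (Sinv u)) -prb.
rewrite F_fourier /op_pi (dual_mul B_dual) F_fourier /lambda_on_A fE -prb.
have [_ [t [tE /= ->]]] := sweedler_fst_coveredl eps_counit (S y) x gl c.
have [[t' [t'E /= ->]] _] := sweedler_fst_coveredr eps_counit y c phil x.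
rewrite (comul_1r_eq eps_counit t'E).
have yl : scalar (fun u => phi (u ∙ y)) by move=> k u v; rewrite nmul_linl phil.
have Syl : scalar (fun u => (phi \o Sinv) (S y ∙ u)).
  by move=> k u v; rewrite nmul_linr gl.
rewrite !slice_fst_snd // -(strong_left_invariance S_antipode phi_left tE) /=.
by rewrite -Smul SK.
Qed.
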